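(* Let $S$ be a Specker $\ell$-group and $\mathfrak m$ a maximal ideal of $S$. Then there is a unique $\ell$-homomorphism $\rho_{\mathfrak m}$ of $S$ onto $\mathbb Z$ (with its natural order) whose kernel $\rho_{\mathfrak m}^{-1}(0)$ is $\mathfrak m$.
   Context: An $\ell$-group is a lattice-ordered abelian group. A singular element of an $\ell$-group $G$ is an element $s\ge0$ such that $a\wedge(s-a)=0$ for all $a$ with $0\le a\le s$. A Specker $\ell$-group is an $\ell$-group generated, as a group, by its singular elements. An ideal of an $\ell$-group is a proper convex $\ell$-subgroup (an $\ell$-ideal different from the whole group); a maximal ideal is one maximal among such. *)

(* Defs.v *)
From HB Require Import structures.
From mathcomp Require Import all_boot all_order all_algebra.
From mathcomp Require Import boolp classical_sets.

Set Implicit Arguments.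
Unset Strict Implicit.
Unset Printing Implicit Defensive.

Import Order.TTheory GRing.Theory Num.Theory.
Local Open Scope classical_set_scope.
Local Open Scope ring_scope.

(* Lattice-ordered abelian groups. Hierarchy-Builder rejects a join of
   GRing.Zmodule and Order.Lattice that lies outside the already declared
   Num.RealDomain, so meet and join are introduced here on top of
   porderZmodType, with the axioms of Order.POrder_isMeetSemilattice and
   Order.POrder_isJoinSemilattice. *)
HB.mixin Record POrderedZmodule_isLGroup G of Num.POrderedZmodule G := {
  lmeet : G -> G -> G;
  ljoin : G -> G -> G;
  le_lmeet : forall x y z : G, (x <= lmeet y z) = (x <= y) && (x <= z);
  ljoin_le : forall x y z : G, (ljoin x y <= z) = (x <= z) && (y <= z);
  lgroup_leD2l : forall x y z : G, x <= y -> z + x <= z + y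
}.

#[short(type="lGroupType")]
HB.structure Definition LGroup :=
  { G of Num.POrderedZmodule G & POrderedZmodule_isLGroup G }.

Fact int_le_min (x y z : int) : (x <= Num.min y z) = (x <= y) && (x <= z).
Proof. exact: le_min. Qed.

Fact int_max_le (x y z : int) : (Num.max x y <= z) = (x <= z) && (y <= z).
Proof. exact: ge_max. Qed.

Fact int_leD2l (x y z : int) : x <= y -> z + x <= z + y.
Proof. by rewrite lerD2l. Qed.

HB.instance Definition _ :=
  POrderedZmodule_isLGroup.Build int int_le_min int_max_le int_leD2l.

Section LGroupDefs.
Variable G : lGroupType.

Definition singular (s : G) : Prop :=
  0 <= s /\ forall a : G, 0 <= a <= s -> lmeet a (s - a) = 0.

Definition subgroup (A : set G) : Prop :=
  A 0 /\ forall x y : G, A x -> A y -> A (x - y).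

Definition sublattice (A : set G) : Prop :=
  forall x y : G, A x -> A y -> A (lmeet x y) /\ A (ljoin x y).

Definition order_convex (A : set G) : Prop :=
  forall a b x : G, A a -> A b -> a <= x <= b -> A x.

Definition lideal (I : set G) : Prop :=
  [/\ subgroup I, sublattice I, order_convex I & I <> [set: G]].

Definition maximal_lideal (I : set G) : Prop :=
  lideal I /\ forall J : set G, lideal J -> I `<=` J -> J = I.

Definition group_span (A : set G) : set G := smallest subgroup A.

Definition specker : Prop := group_span singular = [set: G].

End LGroupDefs.

Definition lgroup_morphism (G H : lGroupType) (f : G -> H) : Prop :=
  [/\ {morph f : x y / x + y},
      {morph f : x y / lmeet x y}
    & {morph f : x y / ljoin x y}].

(* Main.v *)
(** A maximal ideal [m] is prime: if [b] is positive and not in [m], the elements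
    [x] with [|x| /\ b] in [m] form an ideal which contains [m] and misses [b],
    hence equals [m].  If [s] and [t] are singular and not in [m], primality
    applied to the disjoint pairs [(s - s /\ t, t - s /\ t)],
    [(s /\ t, s - s /\ t)] and [(s /\ t, t - s /\ t)] shows that [s - t] is in [m].
    So a fixed singular [s] outside [m] satisfies: every [x] is congruent modulo
    [m] to [n s] for exactly one integer [n], and [rho x] is this [n].  Primality
    also makes [rho] preserve meets and joins.  Any other candidate is a multiple
    of [rho] by a nonnegative integer, which is 1 by surjectivity. *)

Require Import Defs.
From mathcomp Require Import all_boot all_order all_algebra.
From mathcomp Require Import boolp classical_sets.

Import Order.TTheory GRing.Theory Num.Theory.

Local Open Scope classical_set_scope.
Local Open Scope ring_scope.

(** * Order and translation in an l-group *)

Section LGroupTheory.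
Variable G : lGroupType.
Implicit Types (x y z t a b u v s : G) (n : int).

Lemma lg_leD2l z x y : (z + x <= z + y) = (x <= y).
Proof.
apply/idP/idP => [h|]; last exact: lgroup_leD2l.
by have := lgroup_leD2l _ _ (- z) h; rewrite !addKr.
Qed.

Lemma lg_leD2r z x y : (x + z <= y + z) = (x <= y).
Proof. by rewrite !(addrC _ z) lg_leD2l. Qed.

Lemma lg_leD x y z t : x <= y -> z <= t -> x + z <= y + t.
Proof.
move=> xy zt; apply: (@le_trans _ _ (y + z)); first by rewrite lg_leD2r.
by rewrite lg_leD2l.
Qed.

Lemma lg_leBlDr x y z : (x - y <= z) = (x <= z + y).
Proof. by rewrite -[LHS](lg_leD2r y) subrK. Qed.

Lemma lg_leBrDr x y z : (x <= y - z) = (x + z <= y).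
Proof. by rewrite -[LHS](lg_leD2r z) subrK. Qed.

Lemma lg_subr_ge0 x y : (0 <= x - y) = (y <= x).
Proof. by rewrite lg_leBrDr add0r. Qed.

Lemma lg_leN2 x y : (- x <= - y) = (y <= x).
Proof. by rewrite -[LHS](lg_leD2r (x + y)) addKr [x + y]addrC addKr. Qed.

Lemma lg_oppr_le0 x : (- x <= 0) = (0 <= x).
Proof. by rewrite -{1}oppr0 lg_leN2. Qed.

Lemma lg_addr_ge0 x y : 0 <= x -> 0 <= y -> 0 <= x + y.
Proof. by move=> x0 y0; rewrite -[X in X <= _](addr0 0); apply: lg_leD. Qed.

Lemma lg_lerDl x y : (x <= x + y) = (0 <= y).
Proof. by rewrite -{1}(addr0 x) lg_leD2l. Qed.

Lemma lg_lerDr x y : (x <= y + x) = (0 <= y).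
Proof. by rewrite addrC lg_lerDl. Qed.

Lemma lg_mulrn_ge0 x (k : nat) : 0 <= x -> 0 <= x *+ k.
Proof.
move=> x0; elim: k => [|k IH]; first by rewrite mulr0n.
by rewrite mulrS lg_addr_ge0.
Qed.

Lemma lmeet_lel x y : lmeet x y <= x.
Proof. by have := le_lmeet (lmeet x y) x y; rewrite lexx => /esym/andP[]. Qed.

Lemma lmeet_ler x y : lmeet x y <= y.
Proof. by have := le_lmeet (lmeet x y) x y; rewrite lexx => /esym/andP[]. Qed.

Lemma ljoin_gel x y : x <= ljoin x y.
Proof. by have := ljoin_le x y (ljoin x y); rewrite lexx => /esym/andP[]. Qed.

Lemma ljoin_ger x y : y <= ljoin x y.
Proof. by have := ljoin_le x y (ljoin x y); rewrite lexx => /esym/andP[]. Qed.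

(** Moving [lmeet v b] and then [u] to the left reduces this to bounds by single elements. It makes
    the ideal built in [maximal_lideal_prime] closed under sums of bounds. *)
Lemma lmeet_leD u v b : 0 <= u -> 0 <= v -> 0 <= b ->
  lmeet (u + v) b <= lmeet u b + lmeet v b.
Proof.
move=> u0 v0 b0; rewrite -lg_leBlDr le_lmeet; apply/andP; split.
  rewrite lg_leBlDr [leRHS]addrC -lg_leBlDr le_lmeet; apply/andP; split.
    by rewrite lg_leBlDr [leRHS]addrC lmeet_lel.
  by rewrite lg_leBlDr (le_trans (lmeet_ler _ _))// lg_lerDl.
rewrite lg_leBlDr (le_trans (lmeet_ler _ _))// lg_lerDl.
by rewrite le_lmeet v0.
Qed.

(** Adding [lmeet x y] to a common lower bound of the two differences gives a common lower bound of
    [x] and [y], so that bound is at most 0. *)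
Lemma lmeetB_disjoint x y : lmeet (x - lmeet x y) (y - lmeet x y) = 0.
Proof.
apply/eqP; rewrite eq_le; apply/andP; split; last first.
  by rewrite le_lmeet !lg_subr_ge0 lmeet_lel lmeet_ler.
set w := lmeet (_ - _) _.
rewrite -(lg_leD2r (lmeet x y)) add0r le_lmeet -!lg_leBrDr.
by rewrite lmeet_lel lmeet_ler.
Qed.

Lemma ljoinB_disjoint x y : lmeet (ljoin x y - x) (ljoin x y - y) = 0.
Proof.
apply/eqP; rewrite eq_le; apply/andP; split; last first.
  by rewrite le_lmeet !lg_subr_ge0 ljoin_gel ljoin_ger.
set w := lmeet (_ - _) _.
rewrite -(lg_leD2l (ljoin x y)) addr0 -lg_leBrDr ljoin_le.
rewrite !lg_leBrDr ![_ + w]addrC -!lg_leBrDr.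
by rewrite lmeet_lel lmeet_ler.
Qed.

Section Subgroup.
Variables (A : set G) (hA : subgroup A).

Lemma subgroupN x : A x -> A (- x).
Proof. by case: hA => A0 AB Ax; rewrite -(add0r (- x)); apply: AB. Qed.

Lemma subgroupD x y : A x -> A y -> A (x + y).
Proof.
by move=> Ax Ay; rewrite -(opprK y); apply: hA.2 => //; apply: subgroupN.
Qed.

End Subgroup.

(** * Primality of a maximal ideal and singular elements modulo it *)

Section MaximalIdeal.
Variables (m : set G) (hm : maximal_lideal m).

Let m_subgroup : subgroup m. Proof. by case: hm => -[]. Qed.
Let m_lattice : sublattice m. Proof. by case: hm => -[]. Qed.
Let m_convex : order_convex m. Proof. by case: hm => -[]. Qed.
Let m0 : m 0. Proof. exact: m_subgroup.1. Qed.
Let mD x y : m x -> m y -> m (x + y). Proof. exact: subgroupD. Qed.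
Let mB x y : m x -> m y -> m (x - y). Proof. exact: m_subgroup.2. Qed.
Let mN x : m x -> m (- x). Proof. exact: subgroupN. Qed.

Lemma lideal_down u x : m u -> 0 <= x -> x <= u -> m x.
Proof. by move=> mu x0 xu; apply: (m_convex 0 u) => //; rewrite x0. Qed.

Lemma maximal_lideal_prime a b : lmeet a b = 0 -> m a \/ m b.
Proof.
move=> ab0; case: (pselect (m b)) => [|nmb]; [by right|left].
have a0 : 0 <= a by rewrite -ab0 lmeet_lel.
have b0 : 0 <= b by rewrite -ab0 lmeet_ler.
(* A bound [u] with [- u <= x <= u] replaces the absolute value of [x], so closure proofs only have
   to add bounds. *)
pose J := [set x : G | exists u, [/\ 0 <= u, m (lmeet u b), - u <= x & x <= u]].
have JP x u v : 0 <= u -> m (lmeet u b) -> 0 <= v -> m (lmeet v b) ->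
    - (u + v) <= x -> x <= u + v -> J x.
  move=> u0 mu v0 mv xl xr; exists (u + v); split=> //.
    exact: lg_addr_ge0.
  apply: (lideal_down (lmeet u b + lmeet v b)); first exact: mD.
    by rewrite le_lmeet lg_addr_ge0.
  exact: lmeet_leD.
(* [a] is its own bound, as [lmeet a b = 0] is in [m]. *)
suff -> : m = J.
  exists a; rewrite ab0; split=> //.
  by apply: (@le_trans _ _ 0); rewrite ?lg_oppr_le0.
symmetry; apply: hm.2.
  split.
  - split.
      exists 0; rewrite oppr0 lexx; split=> //.
      by apply: (lideal_down 0) => //; [rewrite le_lmeet lexx | exact: lmeet_lel].
    move=> x y [u [u0 mu xl xr]] [v [v0 mv yl yr]]; apply: (JP _ u v) => //.
      by rewrite opprD lg_leD// lg_leN2.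
    by rewrite lg_leD// -(opprK v) lg_leN2.
  - move=> x y [u [u0 mu xl xr]] [v [v0 mv yl yr]].
    have lx : - (u + v) <= x by apply: le_trans xl; rewrite lg_leN2 lg_lerDl.
    have ly : - (u + v) <= y by apply: le_trans yl; rewrite lg_leN2 lg_lerDr.
    have rx : x <= u + v by apply: (le_trans xr); rewrite lg_lerDl.
    have ry : y <= u + v by apply: (le_trans yr); rewrite lg_lerDr.
    split; apply: (JP _ u v) => //.
    + by rewrite le_lmeet lx.
    + exact: le_trans (lmeet_lel _ _) rx.
    + exact: le_trans lx (ljoin_gel _ _).
    + by rewrite ljoin_le rx.
  - move=> x y z [u [u0 mu xl xr]] [v [v0 mv yl yr]] /andP[xz zy].
    apply: (JP _ u v) => //.
      by apply: le_trans xz; apply: le_trans xl; rewrite lg_leN2 lg_lerDl.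
    by apply: (le_trans zy); apply: (le_trans yr); rewrite lg_lerDr.
  (* [J] is proper: a bound [u] of [b] gives [b <= lmeet u b], which would put [b] in [m]. *)
  - move=> JT; have : J b by rewrite JT.
    case=> u [u0 mu _ bu]; apply: nmb.
    by apply: (lideal_down _ _ mu b0); rewrite le_lmeet bu lexx.
(* The bound is the sum of the positive and negative parts of [x], both in [m]. *)
move=> x mx; exists (ljoin x 0 + ljoin (- x) 0).
have xp : 0 <= ljoin x 0 by exact: ljoin_ger.
have xn : 0 <= ljoin (- x) 0 by exact: ljoin_ger.
have mu : m (ljoin x 0 + ljoin (- x) 0).
  by apply: mD; [apply: (m_lattice _ _ mx m0).2|apply: (m_lattice _ _ (mN _ mx) m0).2].
have u0 := lg_addr_ge0 _ _ xp xn.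
split=> //.
- by apply: (lideal_down _ _ mu); [rewrite le_lmeet u0 | exact: lmeet_lel].
- rewrite -(opprK x) lg_leN2 opprK.
  by apply: (le_trans (ljoin_gel _ 0)); rewrite lg_lerDr.
- by apply: (le_trans (ljoin_gel _ 0)); rewrite lg_lerDl.
Qed.

Lemma lmeet_mod_maximal x y : m (x - lmeet x y) \/ m (y - lmeet x y).
Proof. exact/maximal_lideal_prime/lmeetB_disjoint. Qed.

Lemma ljoin_mod_maximal x y : m (ljoin x y - x) \/ m (ljoin x y - y).
Proof. exact/maximal_lideal_prime/ljoinB_disjoint. Qed.

Lemma singular_congr s t :
  singular s -> singular t -> ~ m s -> ~ m t -> m (s - t).
Proof.
move=> [s0 hs] [t0 ht] ms mt; set d := lmeet s t.
have d0 : 0 <= d by rewrite le_lmeet s0.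
have ds : lmeet d (s - d) = 0 by apply: hs; rewrite d0 lmeet_lel.
have dt : lmeet d (t - d) = 0 by apply: ht; rewrite d0 lmeet_ler.
(* One of [s - d] and [t - d] is in [m]; with [d] in [m], so would be [s] or [t]. *)
have nmd : ~ m d.
  move=> md; case: (lmeet_mod_maximal s t) => h.
    by apply: ms; rewrite -(subrK d s); apply: mD.
  by apply: mt; rewrite -(subrK d t); apply: mD.
have -> : s - t = (s - d) - (t - d) by rewrite opprB addrA subrK.
apply: mB.
  by case: (maximal_lideal_prime _ _ ds).
by case: (maximal_lideal_prime _ _ dt).
Qed.

(** Otherwise the subgroup [m] would contain all singular elements, hence everything they generate,
    against properness. *)
Lemma specker_singular_notin : specker G -> exists2 s, singular s & ~ m s.
Proof.
move=> hS; apply: contrapT => hn; case: hm => -[_ _ _ + _]; apply.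
apply/seteqP; split=> // x _.
have : group_span (@singular G) x by rewrite hS.
apply; split=> // s ss; apply: contrapT => nms; apply: hn; by exists s.
Qed.

(** * Integer coefficients modulo [m] along a positive element outside [m] *)

Section Generator.
Variable s : G.
Hypotheses (s0 : 0 <= s) (nms : ~ m s).

Lemma mod_maximal_ge0 x n : 0 <= x -> m (x - s *~ n) -> 0 <= n.
Proof.
(* For [n = - k.+1] the element of [m] is [x + s *+ k.+1], which is at least [s]; convexity would
   put [s] in [m]. *)
case: n => [//|k] x0; rewrite NegzE mulrNz opprK => mx; exfalso; apply: nms.
apply: (lideal_down _ _ mx) => //.
by rewrite -pmulrn mulrS addrCA lg_lerDl lg_addr_ge0// lg_mulrn_ge0.
Qed.

Lemma mod_maximal_le x y n n' :
  x <= y -> m (x - s *~ n) -> m (y - s *~ n') -> n <= n'.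
Proof.
move=> xy mx my; rewrite -subr_ge0; apply: (mod_maximal_ge0 (y - x)).
  by rewrite lg_subr_ge0.
have -> : y - x - s *~ (n' - n) = (y - s *~ n') - (x - s *~ n).
  by rewrite mulrzBr !opprD [RHS]addrACA.
exact: mB.
Qed.

Lemma mod_maximal_inj x n n' : m (x - s *~ n) -> m (x - s *~ n') -> n = n'.
Proof.
move=> h h'; apply/eqP; rewrite eq_le.
by rewrite (mod_maximal_le _ _ _ _ (lexx x) h h') (mod_maximal_le _ _ _ _ (lexx x) h' h).
Qed.

End Generator.

(** The elements congruent to a multiple of [s] form a subgroup. It contains each singular element,
    with coefficient 0 inside [m] and 1 outside. *)
Lemma specker_mod_maximal s x :
  specker G -> singular s -> ~ m s -> exists n, m (x - s *~ n).
Proof.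
move=> hS ss nms; have gx : group_span (@singular G) x by rewrite hS.
apply: (gx [set y | exists n, m (y - s *~ n)]); split=> [|t st].
  split; first by exists 0; rewrite mulr0z subr0.
  move=> y z [n my] [n' mz]; exists (n - n').
  have -> : y - z - s *~ (n - n') = (y - s *~ n) - (z - s *~ n').
    by rewrite mulrzBr !opprD [RHS]addrACA.
  exact: mB.
case: (pselect (m t)) => mt; first by exists 0; rewrite mulr0z subr0.
by exists 1; rewrite mulr1z; apply: singular_congr.
Qed.

End MaximalIdeal.
End LGroupTheory.

(** Positivity of [x] reads [lmeet 0 x = 0], an equation that [f] preserves. *)
Lemma lgroup_morphism_ge0 (G : lGroupType) (f : G -> int) (x : G) :
  lgroup_morphism f -> 0 <= x -> 0 <= f x.
Proof.
move=> [fD fI _] x0.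
have f0 : f 0 = 0 by apply: (addrI (f 0)); rewrite -fD !addr0.
have h : lmeet 0 x = 0.
  by apply/eqP; rewrite eq_le lmeet_lel le_lmeet lexx.
by have := lmeet_ler _ (f 0) (f x); rewrite -fI h f0.
Qed.

Theorem theorem2p4 (S : lGroupType) (hS : specker S)
    (m : set S) (hm : maximal_lideal m) :
  exists! rho : S -> int,
    [/\ lgroup_morphism rho, range rho = [set: int]
      & rho @^-1` [set 0] = m].
Proof.
have [s ss nms] := specker_singular_notin _ _ hm hS.
have s0 : 0 <= s by case: ss.
have m_subgroup : subgroup m by case: hm => -[].
have ex x := specker_mod_maximal _ _ hm s x hS ss nms.
pose rho x : int := projT1 (cid (ex x)).
have rhoP x : m (x - s *~ rho x) by rewrite /rho; case: cid.
(* Uniqueness of the coefficient makes the choice in [rho] immaterial. *)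
have rhoE x n : m (x - s *~ n) -> rho x = n.
  by apply: mod_maximal_inj => //; exact: rhoP.
have rho_le x y : x <= y -> rho x <= rho y.
  by move=> xy; apply: (mod_maximal_le _ _ hm s s0 nms x y).
have rhoD : {morph rho : x y / x + y}.
  move=> x y; apply: rhoE.
  by rewrite mulrzDr opprD addrACA; apply: subgroupD.
have rho_congr x y : m (x - y) -> rho x = rho y.
  move=> mxy; apply: rhoE; rewrite -(subrK y x) -addrA.
  exact: subgroupD.
have rhoK x : rho x = 0 <-> m x.
  split=> [r0|mx]; first by have := rhoP x; rewrite r0 mulr0z subr0.
  by apply: rhoE; rewrite mulr0z subr0.
have rhoZ n : rho (s *~ n) = n by apply: rhoE; rewrite subrr; exact: m_subgroup.1.
exists rho; split.
  split; [split=> // x y| |].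
  - have := rho_le _ _ (lmeet_lel _ x y); have := rho_le _ _ (lmeet_ler _ x y).
    move=> ly lx; apply: le_anti; apply/andP; split; first by rewrite le_lmeet lx ly.
    (* By primality the meet is congruent to [x] or to [y], so its image is [rho x] or [rho y], and
       either one is above their meet. *)
    case: (lmeet_mod_maximal _ _ hm x y) => /rho_congr <-.
      exact: lmeet_lel.
    exact: lmeet_ler.
  - have := rho_le _ _ (ljoin_gel _ x y); have := rho_le _ _ (ljoin_ger _ x y).
    move=> ly lx; apply: le_anti; apply/andP; split; last by rewrite ljoin_le lx ly.
    case: (ljoin_mod_maximal _ _ hm x y) => /rho_congr ->.
      exact: ljoin_gel.
    exact: ljoin_ger.
  - by apply/seteqP; split=> // n _; exists (s *~ n).
  - by apply/seteqP; split=> x /= /rhoK.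
move=> f [fmor fsurj fker]; have [fD _ _] := fmor.
have f0 : f 0 = 0 by apply: (addrI (f 0)); rewrite -fD !addr0.
have fN x : f (- x) = - f x by apply/eqP; rewrite -addr_eq0 -fD addNr f0.
have fMn x (k : nat) : f (x *+ k) = f x *+ k.
  by elim: k => [|k IH]; rewrite ?mulr0n// !mulrS fD IH.
have fM x (n : int) : f (x *~ n) = f x * n.
  case: n => k; first by rewrite -pmulrn fMn -mulr_natr natz.
  by rewrite NegzE mulrNz fN -pmulrn fMn -mulr_natr natz mulrN.
have fE x : f x = f s * rho x.
  have : (f @^-1` [set 0]) (x - s *~ rho x) by rewrite fker.
  by rewrite /= fD fN fM => /eqP; rewrite subr_eq0 => /eqP.
(* Surjectivity makes 1 a multiple of [f s], and positivity of [s] rules out -1. *)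
have fs1 : f s = 1.
  have : range f 1 by rewrite fsurj.
  move=> [x _]; rewrite fE => /eqP.
  have := lgroup_morphism_ge0 _ _ _ fmor s0.
  case: (f s) => // k _ /eqP h.
  have : (k %| 1)%N.
    have /(congr1 absz) := h; rewrite abszM /= => <-; exact: dvdn_mulr.
  by rewrite dvdn1 => /eqP ->.
by apply/funext => x; rewrite fE fs1 mul1r.
Qed.
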